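(* Let $G=(V,E)$ be a distance-regular graph of diameter $d=\mathrm{d}(G)\ge1$ with distinct eigenvalues $k=\theta_0>\theta_1>\cdots>\theta_{d}$, let $t$ be an integer with $0\le t\le d-1$, let $$P(x)=\alpha_1K^{(1)}(x)+\cdots+\alpha_{d}K^{(d)}(x)$$ where $\alpha_i\ge0$ are real numbers, $i=1,\ldots,d$, and $K^{(i)}$ is the degree-$i$ polynomial such that the adjacency matrix of the distance-$i$ graph of $G$ equals $K^{(i)}(A)$, $A$ being the adjacency matrix of $G$. Let $$\mu=\max\{P(\theta_{t+1}),\ldots,P(\theta_{d})\}.$$ If $\mu<0$, then the cardinality of any nonempty algebraic $t$-design $C$ in $G$ satisfies $$\frac{|C|}{|V|}\ \ge\ \frac{-\mu}{P(k)-\mu}.$$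
   Context: For a connected graph $G$, $\mathrm{d}(G)$ is its diameter and $G^{(j)}$ is the simple graph on the same vertices in which two vertices are adjacent iff their distance in $G$ is $j$; $A^{(j)}$ is the adjacency matrix of $G^{(j)}$ (and $A=A^{(1)}$, with $A^{(0)}$ the identity matrix). A simple connected graph $G$ is distance-regular if for each $i=1,\ldots,\mathrm{d}(G)$ the product $A^{(1)}A^{(i)}$ is a linear combination of $A^{(i-1)},A^{(i)},A^{(i+1)}$ (where $A^{(\mathrm{d}(G)+1)}=0$). For such $G$ there are polynomials $K^{(i)}$ of degree $i$, $i=0,\ldots,\mathrm{d}(G)$, with $A^{(i)}=K^{(i)}(A)$. $k$ denotes the degree of $G$, and $G$ has exactly $\mathrm{d}(G)+1$ distinct eigenvalues. Algebraic $t$-design: for a regular graph with distinct eigenvalues $\theta_0>\theta_1>\cdots>\theta_d$ and corresponding eigenspaces $S_0,\ldots,S_d\subseteq\mathbb{C}^V$, a multiset $C$ of vertices is an algebraic $t$-design if in the decomposition $f_C=\varphi_0+\cdots+\varphi_d$, $\varphi_i\in S_i$, of its multiplicity function $f_C$ one has $\varphi_1=\cdots=\varphi_t\equiv0$. The cardinality $|C|$ counts multiplicities. *)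

(* Defs.v *)
From HB Require Import structures.
From mathcomp Require Import all_boot all_order all_algebra.
From mathcomp Require Import finmap multiset complex reals.

Set Implicit Arguments.
Unset Strict Implicit.
Unset Printing Implicit Defensive.

Import GRing.Theory Num.Theory.
Local Open Scope ring_scope.

Section Graph.
Variable V : finType.
Implicit Types e : rel V.

Definition is_simple_connected e : Prop :=
  [/\ symmetric e, irreflexive e & forall x y, connect e x y].

(* Length of a shortest path; a shortest path has fewer than #|V| edges, and
   #|V| is the junk value for disconnected vertices. *)
Definition gdist e (x y : V) : nat :=
  find (fun n => [exists p : n.-tuple V, path e x p && (last x p == y)])
       (iota 0 #|V|).

Definition diameter e : nat := (\max_(p : V * V) gdist e p.1 p.2)%N.

Definition is_regular e (k : nat) : Prop :=
  forall x, #|[set y | e x y]| = k.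

Definition distance_graph e (j : nat) : rel V := [rel x y | gdist e x y == j].

Definition adjmx (F : pzRingType) e : 'M[F]_#|V| :=
  \matrix_(i, j) (e (enum_val i) (enum_val j))%:R.

Definition distmx (F : pzRingType) e (j : nat) : 'M[F]_#|V| :=
  adjmx F (distance_graph e j).

(* distmx e 0 is the identity and distmx e (diameter e).+1 is 0: see distmx0
   and distmx_gt_diameter below. *)
Definition is_distance_regular (F : pzRingType) e : Prop :=
  is_simple_connected e /\
  forall i : nat, (1 <= i <= diameter e)%N ->
    exists a b c : F,
      distmx F e 1 *m distmx F e i =
        a *: distmx F e i.-1 + b *: distmx F e i + c *: distmx F e i.+1.

Definition multiplicity_row (F : pzRingType) (C : {mset V}%mset) :
  'rV[F]_#|V| := \row_i (C (enum_val i))%:R.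

End Graph.

(* p(M); the library's horner_mx needs a dimension of the form n.+1, which
   #|V| is not. *)
Definition mxeval (F : nzRingType) n (p : {poly F}) (M : 'M[F]_n) : 'M[F]_n :=
  \sum_(i < size p) p`_i *: M ^+ i.

Section Design.
Variables (R : realType) (V : finType).
Implicit Types (e : rel V) (theta : nat -> R).
Local Open Scope complex_scope.

(* theta 0 > ... > theta d are all the eigenvalues over the complex numbers;
   the values theta i with d < i are irrelevant. *)
Definition is_spectrum e (d : nat) theta : Prop :=
  (forall i j, (i < j <= d)%N -> theta j < theta i) /\
  (forall a : R[i],
     eigenvalue (adjmx R[i] e) a <-> exists2 i, (i <= d)%N & a = (theta i)%:C).

(* eigenspace consists of row eigenvectors; adjmx is symmetric. Eigenspaces
   are in direct sum, so the decomposition phi is unique. *)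
Definition is_algebraic_design e (d : nat) theta (t : nat) (C : {mset V}%mset) :
    Prop :=
  exists phi : nat -> 'rV[R[i]]_#|V|,
    [/\ forall i, (i <= d)%N ->
          (phi i <= eigenspace (adjmx R[i] e) (theta i)%:C)%MS,
        multiplicity_row R[i] C = \sum_(0 <= i < d.+1) phi i
      & forall i, (1 <= i <= t)%N -> phi i = 0].

End Design.

Section DistanceMatrixFacts.
Variables (F : pzRingType) (V : finType).
Implicit Type e : rel V.

Lemma gdist_eq0 e x y : (gdist e x y == 0%N) = (x == y).
Proof.
have V0 : (0 < #|V|)%N by apply/card_gt0P; exists x.
rewrite /gdist; case: #|V| V0 => // n _ /=.
case: ifP => [/existsP[p]|H]; first by rewrite (tuple0 p) /= => ->.
apply/esym/negbTE; apply/eqP => xy; move/existsP: H; apply.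
by exists [tuple]; rewrite /= xy.
Qed.

Lemma distmx0 e : distmx F e 0 = 1%:M.
Proof.
apply/matrixP => i j; rewrite !mxE /distance_graph /= gdist_eq0.
by rewrite (inj_eq enum_val_inj).
Qed.

Lemma distmx1 e : is_simple_connected e -> distmx F e 1 = adjmx F e.
Proof.
case=> _ irr_e conn_e; apply/matrixP => i j; rewrite !mxE; congr (_%:R).
congr (nat_of_bool _); rewrite /distance_graph /=.
move: (enum_val i) (enum_val j) => x y.
have [<-|xy] := eqVneq x y.
  by rewrite irr_e; have /eqP-> : gdist e x x == 0%N by rewrite gdist_eq0.
have : (1 < #|V|)%N.
  by rewrite (cardD1 x) (cardD1 y) !inE eq_sym xy.
rewrite /gdist; case: #|V| => [|[|n]] //= _.
case: ifP => [/existsP[p]|_]; first by rewrite (tuple0 p) /= (negPf xy).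
have -> : [exists p : 1.-tuple V, path e x p && (last x p == y)] = e x y.
  apply/existsP/idP => [[p]|exy]; last by exists [tuple y]; rewrite /= exy eqxx.
  by case/tupleP: p => z p; rewrite (tuple0 p) /= andbT => /andP[exz /eqP<-].
by case: (e x y).
Qed.

Lemma distmx_gt_diameter e i : (diameter e < i)%N -> distmx F e i = 0.
Proof.
move=> lt_di; apply/matrixP => a b; rewrite !mxE /distance_graph /=.
case: eqP => // eq_i; move: lt_di; rewrite -eq_i ltnNge.
by rewrite /diameter (leq_bigmax (F := fun p => gdist e p.1 p.2)
  (enum_val a, enum_val b)).
Qed.

End DistanceMatrixFacts.

(* Main.v *)
Require Import Defs.
From HB Require Import structures.
From mathcomp Require Import all_boot all_order all_algebra.
From mathcomp Require Import finmap multiset complex reals.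

Set Implicit Arguments.
Unset Strict Implicit.
Unset Printing Implicit Defensive.

Import Order.TTheory GRing.Theory Num.Theory.
Local Open Scope ring_scope.

(** Let [M := P(A)] and let [f] be the multiplicity row of [C], with component
    [phi i] in the eigenspace of [theta i]; the components are orthogonal.
    As [M] and [f] are nonnegative,
      [0 <= f M f^T = \sum_i P(theta i) |phi i|^2
         <= P(k) |phi 0|^2 + mu (|f|^2 - |phi 0|^2)].
    The distance matrices sum to the all-ones matrix [J], so [J] acts on the
    eigenspace of [k] as a scalar; hence this eigenspace consists of constant
    rows and [|phi 0|^2 = |C|^2 / |V|]. Finally [|f|^2 >= |C|], because the
    multiplicities are integers. *)

(** * The bilinear form on rows and symmetric matrices *)

Section DotProduct.
Variables (F : comPzRingType) (n : nat).
Implicit Types (u v : 'rV[F]_n) (A : 'M[F]_n).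

Definition dot u v : F := (u *m v^T) 0 0.

Lemma dotE u v : dot u v = \sum_i u 0 i * v 0 i.
Proof. by rewrite /dot mxE; apply: eq_bigr => i _; rewrite mxE. Qed.

Lemma dotZl a u v : dot (a *: u) v = a * dot u v.
Proof. by rewrite /dot -scalemxAl mxE. Qed.

Lemma dotZr a u v : dot u (a *: v) = a * dot u v.
Proof. by rewrite /dot linearZ -scalemxAr mxE. Qed.

Lemma dot_suml (I : Type) (r : seq I) (u : I -> 'rV[F]_n) v :
  dot (\sum_(i <- r) u i) v = \sum_(i <- r) dot (u i) v.
Proof. by rewrite /dot mulmx_suml summxE. Qed.

Lemma dot_sumr (I : Type) (r : seq I) u (v : I -> 'rV[F]_n) :
  dot u (\sum_(i <- r) v i) = \sum_(i <- r) dot u (v i).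
Proof. by rewrite /dot linear_sum mulmx_sumr summxE. Qed.

Lemma dot_mulmx_sym A u v : A^T = A -> dot (u *m A) v = dot u (v *m A).
Proof. by move=> symA; rewrite /dot trmx_mul symA mulmxA. Qed.

(** The first [const_mx 1] is the square matrix [J], the others are the all-ones row; [J] is the
    outer product of that row with itself. *)
Lemma mulmx_const1 u :
  u *m const_mx 1 = dot u (const_mx 1) *: const_mx 1 :> 'rV[F]_n.
Proof.
by apply/rowP => i; rewrite !mxE dotE mulr1; apply: eq_bigr => j _; rewrite !mxE.
Qed.

End DotProduct.

(** Moving [A] across the form gives [a * dot u v = b * dot u v], and [a - b] can be cancelled. *)
Lemma dot_eigen_eq0 (F : idomainType) n (A : 'M[F]_n) a b (u v : 'rV[F]_n) :
  A^T = A -> u *m A = a *: u -> v *m A = b *: v -> a != b -> dot u v = 0.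
Proof.
move=> symA uA vA neq_ab; have := dot_mulmx_sym u v symA.
rewrite uA vA dotZl dotZr => /eqP; rewrite -subr_eq0 -mulrBl mulf_eq0 subr_eq0.
by rewrite (negPf neq_ab) => /eqP.
Qed.

Lemma mulmx_eigen_mxeval (F : comNzRingType) n (A : 'M[F]_n) a (u : 'rV[F]_n)
    (p : {poly F}) :
  u *m A = a *: u -> u *m mxeval p A = p.[a] *: u.
Proof.
move=> uA; have uAX i : u *m A ^+ i = a ^+ i *: u.
  elim: i => [|i IHi]; first by rewrite !expr0 mulmx1 scale1r.
  by rewrite exprSr mulmxA IHi -scalemxAl uA scalerA exprSr.
rewrite /mxeval mulmx_sumr horner_coef scaler_suml; apply: eq_bigr => i _.
by rewrite -scalemxAr uAX scalerA.
Qed.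

(** * From complex to real eigenvectors *)

Section RealPart.
Variables (R : realType) (n : nat).
Local Open Scope complex_scope.

Lemma Re_sum (I : Type) (r : seq I) (z : I -> R[i]) :
  complex.Re (\sum_(i <- r) z i) = \sum_(i <- r) complex.Re (z i).
Proof. by apply: (big_morph (@complex.Re R)) => // -[x1 y1] [x2 y2]. Qed.

Lemma Re_mulCr (z : R[i]) (a : R) : complex.Re (z * a%:C) = complex.Re z * a.
Proof. by case: z => x y /=; rewrite mulr0 subr0. Qed.

(** As [A] and [a] are real, the equation can be read on real parts. This makes the components of a
    design real, so that [dot] serves as an inner product without conjugation. *)
Lemma map_Re_eigen (A : 'M[R]_n) (a : R) (v : 'rV[R[i]]_n) :
  v *m map_mx (real_complex R) A = a%:C *: v ->
  map_mx (@complex.Re R) v *m A = a *: map_mx (@complex.Re R) v.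
Proof.
move=> /rowP vA; apply/rowP => j; have /(congr1 (@complex.Re R)) := vA j.
rewrite !mxE mulrC Re_mulCr Re_sum mulrC => <-; apply: eq_bigr => i _.
by rewrite !mxE Re_mulCr.
Qed.

Lemma map_Re_sum (I : Type) (r : seq I) (v : I -> 'rV[R[i]]_n) :
  map_mx (@complex.Re R) (\sum_(i <- r) v i) = \sum_(i <- r) map_mx (@complex.Re R) (v i).
Proof.
apply/rowP => j; rewrite mxE !summxE Re_sum.
by apply: eq_bigr => i _; rewrite mxE.
Qed.

End RealPart.

(** * Adjacency and distance matrices *)

Section GraphMatrices.
Variables (V : finType) (e : rel V).

Lemma adjmx_sym (F : pzRingType) : symmetric e -> (adjmx F e)^T = adjmx F e.
Proof. by move=> sym_e; apply/matrixP => i j; rewrite !mxE sym_e. Qed.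

Lemma map_adjmx (F F' : pzRingType) (f : {rmorphism F -> F'}) :
  map_mx f (adjmx F e) = adjmx F' e.
Proof. by apply/matrixP => i j; rewrite !mxE rmorph_nat. Qed.

Lemma sum_enum_val (F : nmodType) (f : V -> F) :
  \sum_(i < #|V|) f (enum_val i) = \sum_x f x.
Proof. by rewrite [RHS]big_enum_val. Qed.

Lemma const1_mul_adjmx (F : pzRingType) k : symmetric e -> is_regular e k ->
  const_mx 1 *m adjmx F e = k%:R *: const_mx 1 :> 'rV[F]_#|V|.
Proof.
move=> sym_e reg; apply/rowP => j; rewrite !mxE mulr1.
under eq_bigr do rewrite !mxE mul1r sym_e.
rewrite (sum_enum_val (fun x => (e (enum_val j) x)%:R)) -natr_sum.
rewrite -(reg (enum_val j)) -sum1_card; congr (_%:R).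
rewrite [RHS]big_mkcond /=.
by apply: eq_bigr => x _; rewrite inE; case: (e _ _).
Qed.

(** Each pair of vertices has exactly one distance, at most the diameter. *)
Lemma sum_distmx (F : pzRingType) :
  \sum_(0 <= i < (diameter e).+1) distmx F e i = const_mx 1.
Proof.
apply/matrixP => a b; rewrite summxE mxE big_mkord.
set g := gdist e (enum_val a) (enum_val b).
have lt_g : (g < (diameter e).+1)%N.
  by rewrite ltnS (leq_bigmax (F := fun p => gdist e p.1 p.2)
    (enum_val a, enum_val b)).
rewrite (bigD1 (Ordinal lt_g)) //= big1 ?addr0 => [|i].
  by rewrite !mxE /distance_graph /= eqxx.
by rewrite -val_eqE !mxE /distance_graph /= eq_sym => /negPf->.
Qed.

Lemma size_mset_sum (C : {mset V}%mset) : size C = (\sum_x C x)%N.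
Proof.
rewrite size_mset big_uniq ?fset_uniq //= big_mkcond /=.
by apply: eq_bigr => x _; case: ifPn => // /fsfun_dflt->.
Qed.

End GraphMatrices.

(** * Spectral bound for a quadratic form *)

Section QuadraticBound.
Variables (R : realType) (n : nat).
Implicit Types (u v f : 'rV[R]_n) (M : 'M[R]_n).

Lemma dot_ge0 u v : (forall i, 0 <= u 0 i) -> (forall i, 0 <= v 0 i) ->
  0 <= dot u v.
Proof. by move=> u0 v0; rewrite dotE sumr_ge0 // => i _; rewrite mulr_ge0. Qed.

Lemma dot_self_ge0 u : 0 <= dot u u.
Proof. by rewrite dotE sumr_ge0 // => i _; rewrite -expr2 sqr_ge0. Qed.

Lemma dot_sum_orthogonal d (phi : nat -> 'rV[R]_n) (c : nat -> R) :
  (forall i j, (i <= d)%N -> (j <= d)%N -> i != j -> dot (phi i) (phi j) = 0) ->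
  dot (\sum_(0 <= i < d.+1) c i *: phi i) (\sum_(0 <= i < d.+1) phi i)
    = \sum_(0 <= i < d.+1) c i * dot (phi i) (phi i).
Proof.
move=> orth; rewrite dot_suml; apply: eq_big_nat => i /= ltid.
rewrite dotZl dot_sumr; congr (_ * _).
rewrite (bigD1_seq i) ?mem_index_iota ?iota_uniq //= big_seq_cond big1 ?addr0 //.
move=> j /andP[]; rewrite mem_index_iota /= ltnS => lejd neqji.
by rewrite orth // eq_sym.
Qed.

(** Component 0 is kept exactly, components 1 to [t] vanish, and on the others [p i] is replaced by
    [mu]. *)
Lemma dot_mulmx_le_spectral d t (phi : nat -> 'rV[R]_n) (p : nat -> R) mu M f :
  (forall i j, (i <= d)%N -> (j <= d)%N -> i != j -> dot (phi i) (phi j) = 0) ->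
  (forall i, (i <= d)%N -> phi i *m M = p i *: phi i) ->
  (forall i, (1 <= i <= t)%N -> phi i = 0) ->
  (forall i, (t < i <= d)%N -> p i <= mu) ->
  f = \sum_(0 <= i < d.+1) phi i ->
  dot (f *m M) f <= (p 0%N - mu) * dot (phi 0%N) (phi 0%N) + mu * dot f f.
Proof.
move=> orth phiM phi0 p_le fE.
have fME : f *m M = \sum_(0 <= i < d.+1) p i *: phi i.
  by rewrite fE mulmx_suml; apply: eq_big_nat => i /= /phiM.
have ffE : dot f f = \sum_(0 <= i < d.+1) dot (phi i) (phi i).
  (* Unit coefficients give the Pythagorean identity. *)
  have := dot_sum_orthogonal (fun=> 1) orth.
  under eq_bigr do rewrite scale1r.
  by rewrite -fE => ->; apply: eq_bigr => i _; rewrite mul1r.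
rewrite fME {1}fE dot_sum_orthogonal // ffE mulr_sumr.
(* The terms of index 0 cancel, since [(p 0 - mu) + mu = p 0]; the rest is compared termwise. *)
rewrite !big_nat_recl // addrA -mulrDl subrK lerD2l.
apply: ler_sum_nat => i /= ltid; have [leit|ltti] := leqP i.+1 t.
  by rewrite phi0 // dotE big1 ?mulr0 // => j _; rewrite mxE mul0r.
by rewrite ler_wpM2r ?dot_self_ge0 // p_le // ltti.
Qed.

End QuadraticBound.

(** * Multiplicity rows and the eigenspace of the degree *)

Section MultiplicityRow.
Variables (R : realType) (V : finType) (e : rel V).
Local Notation A := (adjmx R e).
Local Notation one := (const_mx 1 : 'rV[R]_#|V|).

Lemma multiplicity_row_dot_one (C : {mset V}%mset) :
  dot (multiplicity_row R C) one = (size C)%:R.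
Proof.
rewrite dotE; under eq_bigr do rewrite !mxE mulr1.
by rewrite (sum_enum_val (fun x => (C x)%:R)) -natr_sum -size_mset_sum.
Qed.

Lemma multiplicity_row_dot_self_ge (C : {mset V}%mset) :
  (size C)%:R <= dot (multiplicity_row R C) (multiplicity_row R C).
Proof.
rewrite -multiplicity_row_dot_one !dotE; apply: ler_sum => i _.
rewrite !mxE mulr1 -natrM ler_nat.
by case: (C _) => // m; rewrite leq_pmulr.
Qed.

(** This takes the place of a Perron-Frobenius argument: [J] is the sum of the [K i] at [A], so it
    scales the eigenspace of [k] by [c], while its image consists of constant rows. *)
Lemma regular_eigen_constant k d (K : nat -> {poly R}) (u : 'rV[R]_#|V|) :
  symmetric e -> is_regular e k -> diameter e = d -> (0 < #|V|)%N ->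
  (forall i, (i <= d)%N -> mxeval (K i) A = distmx R e i) ->
  u *m A = k%:R *: u -> #|V|%:R *: u = dot u one *: one.
Proof.
move=> sym_e reg diam V0 KE uA.
pose c := \sum_(0 <= i < d.+1) (K i).[k%:R].
have JE (v : 'rV[R]_#|V|) : v *m A = k%:R *: v -> c *: v = dot v one *: one.
  move=> vA; rewrite -mulmx_const1 -(sum_distmx e) diam mulmx_sumr scaler_suml.
  by apply: eq_big_nat => i /= ltid; rewrite -KE // (mulmx_eigen_mxeval _ vA).
(* The all-ones row is an eigenvector for [k]; one coordinate of [JE] at this row gives
   [c = #|V|]. *)
have /rowP/(_ (Ordinal V0)) := JE _ (const1_mul_adjmx R sym_e reg).
rewrite dotE !mxE !mulr1; under eq_bigr do rewrite !mxE mulr1.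
by rewrite sumr_const card_ord => <-; exact: JE.
Qed.

End MultiplicityRow.

Theorem lemma18 (R : realType) (V : finType) (e : rel V) (d k t : nat)
    (theta : nat -> R) (K : nat -> {poly R}) (alpha : nat -> R)
    (drg : is_distance_regular R e)
    (diam : diameter e = d) (d_ge1 : (1 <= d)%N)
    (reg : is_regular e k)
    (spec : is_spectrum e d theta) (theta0 : theta 0%N = k%:R)
    (t_le : (0 <= t <= d - 1)%N)
    (KP : forall i, (i <= d)%N ->
       size (K i) = i.+1 /\ mxeval (K i) (adjmx R e) = distmx R e i)
    (alpha_ge0 : forall i, (1 <= i <= d)%N -> 0 <= alpha i) :
  let P := \sum_(1 <= i < d.+1) alpha i *: K i in
  let mu := \big[Num.max/P.[theta t.+1]]_(t.+1 <= i < d.+1) P.[theta i] in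
  mu < 0 ->
  forall C : {mset V}%mset,
    C != mset0 -> is_algebraic_design e d theta t C ->
    (size C)%:R / #|V|%:R >= - mu / (P.[k%:R] - mu).
Proof.
move=> P mu mu_lt0 C C_neq0 [phi [phi_eig CE phi0]].
have [[sym_e _ _] _] := drg; have [theta_lt _] := spec.
pose f := multiplicity_row R C.
pose psi i := map_mx (@complex.Re R) (phi i).
pose M := \sum_(1 <= i < d.+1) alpha i *: distmx R e i.
have psiA i : (i <= d)%N -> psi i *m adjmx R e = theta i *: psi i.
  move=> /phi_eig/eigenspaceP phiA; apply: map_Re_eigen.
  by rewrite (map_adjmx e (real_complex R)).
have fE : f = \sum_(0 <= i < d.+1) psi i.
  rewrite -map_Re_sum -CE; apply/rowP => i; rewrite !mxE.
  by rewrite -(rmorph_nat (real_complex R)).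
have orth i j : (i <= d)%N -> (j <= d)%N -> i != j -> dot (psi i) (psi j) = 0.
  move=> leid lejd; rewrite neq_ltn => neq_ij.
  apply: (dot_eigen_eq0 (adjmx_sym _ sym_e) (psiA i leid) (psiA j lejd)).
  case/orP: neq_ij => [ltij|ltji]; last by rewrite lt_eqF // theta_lt ?ltji.
  by rewrite gt_eqF // theta_lt ?ltij.
have MP a (u : 'rV_#|V|) : u *m adjmx R e = a *: u -> u *m M = P.[a] *: u.
  move=> uA; rewrite mulmx_sumr horner_sum scaler_suml.
  apply: eq_big_nat => i /andP[_ leid]; have [_ <-] := KP i leid.
  by rewrite -scalemxAr (mulmx_eigen_mxeval _ uA) hornerZ scalerA.
have M_ge0 i j : 0 <= M i j.
  rewrite summxE big_nat_cond sumr_ge0 // => l /andP[ld _].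
  by rewrite !mxE mulr_ge0 ?alpha_ge0.
have f_ge0 i : 0 <= f 0 i by rewrite mxE.
have C_gt0 : (0 < size C)%N by rewrite lt0n size_mset_eq0.
have V_gt0 : (0 < #|V|)%N.
  rewrite lt0n; apply: contraTneq C_gt0 => V0.
  by rewrite size_mset_sum big1 // => x; have := card0_eq V0 x.
(* [P.[k%:R]] is a column sum of the nonnegative matrix [M]; this makes the final denominator
   positive. *)
have Pk_ge0 : 0 <= P.[k%:R].
  have /rowP/(_ (Ordinal V_gt0)) := MP _ _ (const1_mul_adjmx R sym_e reg).
  rewrite !mxE mulr1 => <-; apply: sumr_ge0 => i _.
  by rewrite mxE mul1r.
have le_mu i : (t < i <= d)%N -> P.[theta i] <= mu.
  move=> ltid; apply: (le_bigmax_seq _ _ xpredT (fun j => P.[theta j])) => //.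
  by rewrite mem_index_iota.
have psi0 i : (1 <= i <= t)%N -> psi i = 0.
  by move=> lit; apply/rowP => j; rewrite /psi phi0 // !mxE.
have := dot_mulmx_le_spectral orth (fun i leid => MP _ _ (psiA i leid))
  psi0 le_mu fE.
rewrite theta0 => bound.
have fMf_ge0 : 0 <= dot (f *m M) f.
  by apply: dot_ge0 => // i; rewrite mxE sumr_ge0 // => j _; rewrite mulr_ge0.
have one_eig := const1_mul_adjmx R sym_e reg.
(* The all-ones row belongs to [theta 0 = k], so it is orthogonal to every [psi i] with [i > 0]. *)
have s_psi0 : dot (psi 0%N) (const_mx 1) = (size C)%:R.
  rewrite -multiplicity_row_dot_one -/f fE dot_suml big_nat_recl //.
  rewrite big_nat_cond big1 ?addr0 // => i /andP[/= ltid _].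
  apply: (dot_eigen_eq0 (adjmx_sym _ sym_e) (psiA _ ltid) one_eig).
  by rewrite -theta0 lt_eqF // theta_lt.
have psi0A : psi 0%N *m adjmx R e = k%:R *: psi 0%N by rewrite psiA ?theta0.
have psi0E := regular_eigen_constant sym_e reg diam V_gt0
  (fun i leid => (KP i leid).2) psi0A.
have nV_gt0 : 0 < #|V|%:R :> R by rewrite ltr0n.
have dot_psi0 : dot (psi 0%N) (psi 0%N) = (size C)%:R ^+ 2 / #|V|%:R.
  (* After scaling by [#|V|], one factor [psi 0] becomes [size C] times the all-ones row. *)
  apply: (mulfI (lt0r_neq0 nV_gt0)).
  rewrite -dotZr psi0E dotZr s_psi0 mulrCA mulfV ?lt0r_neq0 // mulr1.
  by rewrite expr2.
have nC_gt0 : 0 < (size C)%:R :> R by rewrite ltr0n.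
have Pmu_gt0 : 0 < P.[k%:R] - mu by rewrite subr_gt0 (lt_le_trans mu_lt0).
have ff_ge := multiplicity_row_dot_self_ge R C.
have : 0 <= (P.[k%:R] - mu) * ((size C)%:R ^+ 2 / #|V|%:R) + mu * (size C)%:R.
  (* Since [mu < 0], the lower bound on [dot f f] becomes an upper bound on [mu * dot f f]. *)
  apply: le_trans fMf_ge0 (le_trans bound _); rewrite dot_psi0 lerD2l.
  by rewrite ler_wnM2l // ltW.
(* The positive factor [size C] is divided out. *)
rewrite expr2 -mulrA mulrCA [mu * _]mulrC -mulrDr pmulr_rge0 //.
by rewrite -(opprK mu) subr_ge0 opprK ler_pdivrMr // mulrC.
Qed.
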